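(* Let $M$ be a matroid, and let $N$ be a matroid whose ground set is the set of circuits of $M$, such that: if $\mathcal{C}'$ is a perfect collection of circuits of $M$, then each circuit $C'$ of $M$ contained in $\bigcup_{C\in\mathcal{C}'}C$ satisfies $C'\in\mathrm{cl}_N(\mathcal{C}')$. Then the function $r_{M^N}$ defined, for all $X\subseteq E(M)$, by $$r_{M^N}(X)=r_M(X)+r_N(\{C\colon C \text{ is a circuit of } M|X\})$$ is the rank function of a matroid $M^N$ on $E(M)$ which is a rank-$r(N)$ lift of $M$.
   Context: Matroids are finite; $r_M$ denotes the rank function of $M$, $r(M)$ its rank, $\mathrm{cl}_N$ the closure operator of $N$. A collection $\mathcal{C}'$ of circuits of $M$ is perfect if $|\bigcup_{C\in\mathcal{C}'}C|-r_M(\bigcup_{C\in\mathcal{C}'}C)=|\mathcal{C}'|$, and no circuit in $\mathcal{C}'$ is contained in the union of the others. A matroid $K$ is a lift of a matroid $M$ if there is a matroid $P$ and a subset $X$ of $E(P)$ so that $P\setminus X=K$ (deletion) and $P/X=M$ (contraction). If $r(K)-r(M)=k$, then $K$ is a rank-$k$ lift of $M$. *)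

(* Defs.v *)
From HB Require Import structures.
From mathcomp Require Import all_boot.

Set Implicit Arguments.
Unset Strict Implicit.
Unset Printing Implicit Defensive.

(* The axioms are boolean, so that two matroids are equal as soon as they have
   the same ground set and the same independent sets (lemma matroid_eq). *)
Definition matroid_axiom (T : finType) (E : {set T}) (I : {set {set T}}) : bool :=
  [&& [forall A in I, A \subset E],
      set0 \in I,
      [forall A in I, forall B : {set T}, (B \subset A) ==> (B \in I)] &
      [forall A in I, forall B in I, (#|A| < #|B|) ==>
         [exists x in B :\: A, x |: A \in I]]].

(* The ground set is a subset of the carrier T, not necessarily all of T. *)
Record matroid (T : finType) := Matroid {
  ground : {set T};
  indep : {set {set T}};
  matroidP : matroid_axiom ground indep }.

Lemma matroid_axiomP (T : finType) (E : {set T}) (I : {set {set T}}) :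
  reflect [/\ forall A, A \in I -> A \subset E,
              set0 \in I,
              forall A B : {set T}, A \in I -> B \subset A -> B \in I &
              forall A B : {set T}, A \in I -> B \in I -> #|A| < #|B| ->
                exists2 x, x \in B :\: A & x |: A \in I]
          (matroid_axiom E I).
Proof.
apply: (iffP and4P) => [[h1 h2 h3 h4]|[h1 h2 h3 h4]]; split=> //.
- by move=> A AI; apply: (implyP (forallP h1 A)).
- move=> A B AI; exact/implyP/(forallP (implyP (forallP h3 A) AI)).
- move=> A B AI BI ltAB.
  have /existsP[x /andP[xBA xA]] :=
    implyP (implyP (forallP (implyP (forallP h4 A) AI) B) BI) ltAB.
  by exists x.
- by apply/forall_inP.
- by apply/forall_inP=> A AI; apply/forallP=> B; apply/implyP; apply: h3.
- apply/forall_inP=> A AI; apply/forall_inP=> B BI; apply/implyP=> ltAB.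
  by have [x xBA xA] := h4 A B AI BI ltAB; apply/existsP; exists x; rewrite xBA.
Qed.

Lemma matroid_eq (T : finType) (M N : matroid T) :
  ground M = ground N -> indep M = indep N -> M = N.
Proof.
case: M N => [E I p] [E' I' p'] /= eE eI; subst E' I'.
by rewrite (bool_irrelevance p p').
Qed.

Section Basics.
Variable T : finType.
Implicit Types (M : matroid T) (X B C I : {set T}).

Definition rank M X : nat := \max_(I in indep M | I \subset X) #|I|.

Definition matroid_rank M : nat := rank M (ground M).

Definition circuits M : {set {set T}} :=
  [set C : {set T} |
    minset [pred X : {set T} | (X \subset ground M) && (X \notin indep M)] C].

Definition cl M X : {set T} := [set e in ground M | rank M (e |: X) == rank M X].

Definition is_basis M X B : bool :=
  maxset [pred I : {set T} | (I \in indep M) && (I \subset X)] B.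

(* The subtraction is exact: rank M X never exceeds #|X|. *)
Definition perfect M (CC : {set {set T}}) : Prop :=
  [/\ CC \subset circuits M,
      #|cover CC| - rank M (cover CC) = #|CC| &
      forall C, C \in CC -> ~~ (C \subset cover (CC :\ C))].

Lemma restrict_axiom M X :
  matroid_axiom (ground M :&: X) [set I in indep M | I \subset X].
Proof.
have /matroid_axiomP[h1 h2 h3 h4] := matroidP M.
apply/matroid_axiomP; split.
- by move=> A; rewrite inE subsetI => /andP[/h1 -> ->].
- by rewrite inE h2 sub0set.
- move=> A B; rewrite !inE => /andP[AI AX] BA.
  by rewrite (h3 A) //= (subset_trans BA).
- move=> A B; rewrite !inE => /andP[AI AX] /andP[BI BX] ltAB.
  have [x xBA xA] := h4 A B AI BI ltAB; exists x => //.
  rewrite inE xA /= subUset AX andbT sub1set (subsetP BX) //.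
  by case/setDP: xBA.
Qed.

Definition restrict M X : matroid T := Matroid (restrict_axiom M X).

Definition delete M X : matroid T := restrict M (~: X).

Lemma contract_axiom M X :
  matroid_axiom (ground M :\: X)
    [set I : {set T} | [disjoint I & X] &&
       [exists B : {set T}, is_basis M X B && (I :|: B \in indep M)]].
Proof.
have /matroid_axiomP[h1 h2 h3 h4] := matroidP M.
have basisS B : is_basis M X B -> (B \in indep M) /\ (B \subset X).
  by case/maxsetP=> /andP[].
have basis_le B B' : is_basis M X B -> is_basis M X B' -> #|B'| <= #|B|.
  move=> bB bB'; rewrite leqNgt; apply/negP=> ltB.
  have [[BI BX] [BI' BX']] := (basisS _ bB, basisS _ bB').
  have [x /setDP[xB' xB] xI] := h4 _ _ BI BI' ltB.
  case/maxsetP: bB => _ /(_ (x |: B)) /= maxB.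
  case/negP: xB; rewrite -maxB ?setU11 ?subsetUr //.
  by rewrite xI subUset sub1set BX (subsetP BX').
apply/matroid_axiomP; split.
- move=> A; rewrite inE => /andP[dAX /existsP[B /andP[_ /h1]]].
  by rewrite subUset subsetD dAX => /andP[->].
- rewrite inE -setI_eq0 set0I eqxx /=.
  have [|B bB _] := @maxset_exists T
    [pred I : {set T} | (I \in indep M) && (I \subset X)] set0.
    by rewrite /= h2 sub0set.
  by apply/existsP; exists B; rewrite /is_basis bB set0U; case/basisS: (bB).
- move=> A B; rewrite !inE => /andP[dAX /existsP[D /andP[bD ADI]]] BA.
  rewrite (disjointWl BA dAX); apply/existsP; exists D; rewrite bD.
  by rewrite (h3 _ _ ADI) // setSU.
- move=> A A'; rewrite !inE => /andP[dA /existsP[B /andP[bB AI]]].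
  case/andP=> dA' /existsP[B' /andP[bB' AI']] ltA.
  have [[BI BX] [BI' BX']] := (basisS _ bB, basisS _ bB').
  have card_dis (D C : {set T}) : [disjoint D & X] -> C \subset X ->
      #|D :|: C| = #|D| + #|C|.
    move=> dDX CX; rewrite cardsU; have /eqP -> : D :&: C == set0.
      by rewrite setI_eq0 (disjointWr CX).
    by rewrite cards0 subn0.
  have ltU : #|A :|: B| < #|A' :|: B'|.
    rewrite !card_dis //; rewrite -addSn leq_add //.
    exact: basis_le.
  have [x /setDP[xU' xU] xI] := h4 _ _ AI AI' ltU.
  have xNX : x \notin X.
    apply/negP=> xX; case/negP: xU; rewrite inE orbC.
    case/maxsetP: (bB) => _ /(_ (x |: B)) /= maxB.
    rewrite -{1}maxB ?setU11 ?subsetUr //.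
    rewrite (h3 _ _ xI) ?setUS ?subsetUr //=.
    by rewrite subUset sub1set xX.
  have xA' : x \in A'.
    case/setUP: xU' => // xB'.
    by rewrite (subsetP BX' _ xB') in xNX.
  exists x; first by move: xU; rewrite !inE negb_or xA' => /andP[->].
  rewrite inE -setI_eq0 setIUl setU_eq0 !setI_eq0 disjoints1 xNX dA /=.
  by apply/existsP; exists B; rewrite bB -setUA.
Qed.

Definition contract M X : matroid T := Matroid (contract_axiom M X).

End Basics.

Lemma relabel_axiom (T U : finType) (f : T -> U) (f_inj : injective f)
    (M : matroid T) :
  matroid_axiom (f @: ground M) [set f @: (I : {set T}) | I in indep M].
Proof.
have /matroid_axiomP[h1 h2 h3 h4] := matroidP M.
apply/matroid_axiomP; split.
- by move=> _ /imsetP[I /h1 IE ->]; apply: imsetS.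
- by apply/imsetP; exists set0; rewrite ?imset0.
- move=> _ B /imsetP[I II ->] BI; apply/imsetP; exists (f @^-1: B).
    apply: h3 II _; apply/subsetP=> x; rewrite inE => /(subsetP BI).
    by rewrite mem_imset.
  apply/setP=> y; apply/idP/imsetP=> [yB|[x]]; last by rewrite inE => ? ->.
  by have /imsetP[x _ yx] := subsetP BI _ yB; exists x; rewrite // inE -yx.
- move=> _ _ /imsetP[I II ->] /imsetP[J JI ->]; rewrite !card_imset // => lt.
  have [x xJI xI] := h4 _ _ II JI lt; exists (f x).
    by move: xJI; rewrite !inE !mem_imset.
  by apply/imsetP; exists (x |: I); rewrite ?imsetU1.
Qed.

Definition relabel (T U : finType) (f : T -> U) (f_inj : injective f)
  (M : matroid T) : matroid U := Matroid (relabel_axiom f_inj M).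

(* T may have no elements outside the ground sets of K and M, so the matroid P
   lives on a finite type U into which T is embedded. *)
Definition is_lift (T : finType) (K M : matroid T) : Prop :=
  exists (U : finType) (f : T -> U) (f_inj : injective f)
         (P : matroid U) (X : {set U}),
    [/\ X \subset ground P,
        delete P X = relabel f_inj K &
        contract P X = relabel f_inj M].

Definition is_rank_lift (T : finType) (k : nat) (K M : matroid T) : Prop :=
  is_lift K M /\ matroid_rank K = matroid_rank M + k.

Definition lift_rank (T : finType) (M : matroid T) (N : matroid {set T})
  (X : {set T}) : nat := rank M X + rank N (circuits (restrict M X)).

(* Main.v *)
Require Import Defs.
From HB Require Import structures.
From mathcomp Require Import all_boot.

Set Implicit Arguments.
Unset Strict Implicit.
Unset Printing Implicit Defensive.

(** One matroid P produces both M^N and the lift. Its ground set is the disjoint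
    union of E(M) and the set of circuits of M, and for a set A of points and a
    set S of circuits
      r_P(A u S) = r_M(A) + r_N({C : C a circuit of M|A} u S).
    For S empty this is r_{M^N}(A), so deleting all circuits from P leaves M^N.
    Contracting them leaves M: once every circuit is present the second term is
    constantly r(N), and only r_M(A) remains.

    What has to be shown is that r_P is a rank function (rank_function_joint),
    that is, that it vanishes on the empty set, grows by 0 or 1 when an element
    is added, and does not grow when two elements are added neither of which
    makes it grow alone. The growth of the term r_N is controlled by fundamental
    circuits. If B is a basis of M|X, choose for each e in X - B a circuit
    inside B u e; these circuits form a perfect collection whose union contains every
    circuit of M|X (perfect_fundamental, circuit_sub_cover_fundamental), so by
    hypothesis they span all circuits of M|X in N (circuits_spanned).

    If x lies in the closure of X, a basis of X is still a basis of X u x, and a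
    single new fundamental circuit spans whatever is new, so r_N grows by at
    most 1; if x is not in the closure, r_M grows by 1 and there is no new circuit
    (joint_rank_adjoin). If x and y both lie in the closure of X, each
    fundamental circuit of X u {x, y} lies in X u x or in X u y, so the circuits of
    X u {x, y} are spanned in N by those of X u x and X u y
    (circuits_adjoin_spanned2); this gives the last condition. *)

(** * Rank functions *)

Lemma setU1_id (T : finType) (x : T) (A : {set T}) : x \in A -> x |: A = A.
Proof. by move=> xA; apply/setUidPr; rewrite sub1set. Qed.

Lemma subset_adjoin (T : finType) (x : T) (A B : {set T}) :
  x \notin A -> A \subset x |: B -> A \subset B.
Proof.
by move=> xA; rewrite -subDset (setDidPl _) // disjoint_sym disjoints1.
Qed.

(** The last condition is the local form of submodularity. It is the easiest
    to check and, with unit increase, is equivalent to submodularity. *)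
Definition rank_function (T : finType) (rho : {set T} -> nat) : Prop :=
  [/\ rho set0 = 0,
      forall x X, rho X <= rho (x |: X) <= (rho X).+1 &
      forall x y X, rho (x |: X) = rho X -> rho (y |: X) = rho X ->
        rho (x |: (y |: X)) = rho X].

Section RankFunctionTheory.
Variables (T : finType) (rho : {set T} -> nat).
Hypothesis rhoP : rank_function rho.
Implicit Types (x y : T) (V W X Y Z I J : {set T}).

Lemma rank_function_growth X Y : rho X <= rho (Y :|: X) <= rho X + #|Y|.
Proof.
have [_ rho1 _] := rhoP.
rewrite cardE -[in rho (Y :|: X)](set_enum Y).
elim: (enum Y) => [|y s /andP[lo hi]].
  by rewrite set_nil set0U addn0 !leqnn.
rewrite set_cons -setUA /= addnS.
have /andP[lo1 hi1] := rho1 y ([set z in s] :|: X).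
by rewrite (leq_trans lo lo1) (leq_trans hi1).
Qed.

Lemma rank_function_mono X Y : X \subset Y -> rho X <= rho Y.
Proof.
by move=> /setUidPl <-; have /andP[] := rank_function_growth X Y.
Qed.

Lemma rank_function_le_card X : rho X <= #|X|.
Proof.
have [rho0 _ _] := rhoP.
by have /andP[_] := rank_function_growth set0 X; rewrite setU0 rho0.
Qed.

(** Closure is monotone. Along Y one element y at a time: either y leaves the
    rank unchanged and local submodularity applies, or y uses up a unit of
    growth, which bounds the rank of x, y and X together. *)
Lemma spanned_mono x X Y :
  X \subset Y -> rho (x |: X) = rho X -> rho (x |: Y) = rho Y.
Proof.
have [_ rho1 rho2] := rhoP.
move=> /setUidPl <-; rewrite -[Y]set_enum.
elim: (enum Y) => [|y s IHs] xX; first by rewrite set_nil set0U.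
rewrite set_cons -setUA; move: (_ :|: X) {IHs xX}(IHs xX) => {}X xX.
have /andP[lo hi] := rho1 y X.
have [eqy|neqy] := eqVneq (rho (y |: X)) (rho X); first by rewrite rho2.
have ltX : rho X < rho (y |: X) by rewrite ltn_neqAle eq_sym neqy.
have /andP[lox _] := rho1 x (y |: X).
apply/eqP; rewrite eqn_leq lox andbT.
apply: leq_trans ltX; rewrite setUCA -xX.
by case/andP: (rho1 y (x |: X)).
Qed.

Lemma spanned_set V W :
  (forall x, x \in W -> rho (x |: V) = rho V) -> rho (W :|: V) = rho V.
Proof.
move=> WV; have {}WV x : x \in enum W -> rho (x |: V) = rho V.
  by rewrite mem_enum; apply: WV.
rewrite -[W]set_enum; elim: (enum W) V WV => [|y s IHs] V WV.
  by rewrite set_nil set0U.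
have yV : rho (y |: V) = rho V by apply: WV; rewrite mem_head.
rewrite set_cons -setUA setUCA IHs // => x xs.
have [_ _ rho2] := rhoP; rewrite rho2 // WV // inE xs orbT //.
Qed.

Lemma spanned_in X Y x :
  X \subset Y -> rho Y = rho X -> x \in Y -> rho (x |: X) = rho X.
Proof.
move=> XY rXY xY; apply/eqP; rewrite eqn_leq -{1}rXY.
by rewrite !rank_function_mono ?subsetUr // subUset sub1set xY.
Qed.

Lemma spanned_trans V W Z :
  rho (W :|: V) = rho V ->
  (forall x, x \in Z -> rho (x |: W) = rho W) ->
  rho (Z :|: V) = rho V.
Proof.
move=> WV ZW; apply: spanned_set => x xZ; apply/eqP.
rewrite eqn_leq (@rank_function_mono V) ?subsetUr // andbT -[leqRHS]WV.
rewrite -(@spanned_mono x W (W :|: V)) ?subsetUl ?ZW //.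
by rewrite rank_function_mono // setUS // subsetUr.
Qed.

Definition rank_function_indep : {set {set T}} := [set I | rho I == #|I|].

Section FromRank.
Variable E : {set T}.
Hypothesis rhoE : forall x, x \notin E -> rho [set x] = 0.

(** Augmentation is the contrapositive of [spanned_set]: if no element of J
    augments I, then I spans J and is at least as large. *)
Lemma matroid_of_rank_axiom : matroid_axiom E rank_function_indep.
Proof.
have [rho0 rho1 _] := rhoP.
have indepS I J : I \in rank_function_indep -> J \subset I ->
    J \in rank_function_indep.
  rewrite !inE => /eqP rI JI; rewrite eqn_leq rank_function_le_card /=.
  have /andP[_] := rank_function_growth J (I :\: J).
  have -> : I :\: J :|: J = I by rewrite setUC -{1}(setIidPr JI) setID.
  by rewrite rI cardsDS // addnC -leq_subLR subKn // subset_leq_card.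
apply/matroid_axiomP; split=> //.
- move=> I II; apply/subsetP=> x xI; apply/negPn/negP=> xE.
  have := indepS I [set x] II; rewrite sub1set => /(_ xI).
  by rewrite inE cards1 rhoE.
- by rewrite inE rho0 cards0.
- move=> I J; rewrite !inE => /eqP rI /eqP rJ ltIJ.
  apply/exists_inP; apply: contraLR ltIJ => /exists_inPn noaug.
  rewrite -leqNgt -rI -rJ -(@spanned_set I J).
    by rewrite rank_function_mono ?subsetUl.
  move=> x xJ; have [xI|xI] := boolP (x \in I); first by rewrite setU1_id.
  have /andP[lo hi] := rho1 x I.
  have := noaug x; rewrite !inE xI xJ cardsU1 xI add1n -rI => /(_ isT) ne.
  by apply/eqP; rewrite eqn_leq lo andbT -ltnS ltn_neqAle ne hi.
Qed.

Definition matroid_of_rank : matroid T := Matroid matroid_of_rank_axiom.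

Lemma rank_matroid_of_rank X : rank matroid_of_rank X = rho X.
Proof.
apply/eqP; rewrite eqn_leq; apply/andP; split.
  apply/bigmax_leqP=> I /andP[]; rewrite inE => /eqP <-.
  exact: rank_function_mono.
have [rho0 rho1 _] := rhoP.
pose P I := (rho I == #|I|) && (I \subset X).
have [|I /maxsetP[/andP[/eqP rI IX] maxI] _] := @maxset_exists T P set0.
  by rewrite /P rho0 cards0 sub0set.
rewrite (leq_trans _ (leq_bigmax_cond I _)) ?inE ?rI ?eqxx //.
rewrite -(setUidPl IX) (@spanned_set I X) => [|x xX]; first by rewrite rI.
have [xI|xI] := boolP (x \in I); first by rewrite setU1_id.
have /andP[lo hi] := rho1 x I.
apply/eqP; rewrite eqn_leq lo andbT -ltnS ltn_neqAle hi andbT.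
apply: contra (xI) => /eqP rxI; rewrite -(maxI (x |: I)) ?setU11 ?subsetUr //.
by rewrite /P rxI rI cardsU1 xI eqxx subUset sub1set xX.
Qed.

End FromRank.
End RankFunctionTheory.

(** * Rank and circuits of a matroid *)

Section MatroidRank.
Variables (T : finType) (M : matroid T).
Implicit Types (x y : T) (X Y I B C : {set T}).

Let indep_ground I : I \in indep M -> I \subset ground M.
Proof. by have /matroid_axiomP[h _ _ _] := matroidP M; apply: h. Qed.

Let indep0 : set0 \in indep M.
Proof. by have /matroid_axiomP[] := matroidP M. Qed.

Let indepS I Y : I \in indep M -> Y \subset I -> Y \in indep M.
Proof. by have /matroid_axiomP[_ _ h _] := matroidP M; apply: h. Qed.

Let indep_aug I Y : I \in indep M -> Y \in indep M -> #|I| < #|Y| ->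
  exists2 x, x \in Y :\: I & x |: I \in indep M.
Proof. by have /matroid_axiomP[_ _ _ h] := matroidP M; apply: h. Qed.

Lemma leq_rank I X : I \in indep M -> I \subset X -> #|I| <= rank M X.
Proof. by move=> iI IX; apply: leq_bigmax_cond; rewrite iI. Qed.

Lemma rank_subset X Y : X \subset Y -> rank M X <= rank M Y.
Proof.
move=> XY; apply/bigmax_leqP=> I /andP[iI IX].
by rewrite leq_rank // (subset_trans IX).
Qed.

Lemma basis_exists X : exists B, is_basis M X B.
Proof.
have [|B bB _] := @maxset_exists T
  [pred I : {set T} | (I \in indep M) && (I \subset X)] set0.
  by rewrite /= indep0 sub0set.
by exists B.
Qed.

Lemma basisP X B :
  is_basis M X B -> [/\ B \in indep M, B \subset X & rank M X = #|B|].
Proof.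
case/maxsetP=> /andP[iB BX] maxB; split=> //.
apply/eqP; rewrite eqn_leq leq_rank // andbT.
apply/bigmax_leqP=> I /andP[iI IX]; rewrite leqNgt; apply/negP=> ltBI.
have [x /setDP[xI xB] xiB] := indep_aug iB iI ltBI.
case/negP: xB; rewrite -(maxB (x |: B)) ?setU11 ?subsetUr //=.
by rewrite xiB subUset sub1set BX (subsetP IX).
Qed.

Lemma rank_function_rank : rank_function (rank M).
Proof.
split.
- apply/eqP; rewrite -leqn0; apply/bigmax_leqP=> I /andP[_].
  by rewrite subset0 => /eqP ->; rewrite cards0.
- move=> x X; rewrite rank_subset ?subsetUr //=.
  apply/bigmax_leqP=> I /andP[iI IxX].
  rewrite (cardsD1 x) -[in X in _ <= X]add1n leq_add ?leq_b1 ?leq_rank //.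
    by rewrite (indepS iI) ?subsetDl.
  by rewrite subDset.
- move=> x y X rx ry.
  have [B /basisP[iB BX rX]] := basis_exists X.
  apply/eqP; rewrite eqn_leq (rank_subset (X := X)); last first.
    by rewrite setUA subsetUr.
  rewrite andbT; apply/bigmax_leqP=> I /andP[iI IxyX].
  rewrite rX leqNgt; apply/negP=> ltBI.
  have [z /setDP[zI zB] ziB] := indep_aug iB iI ltBI.
  have rz : rank M (z |: X) = rank M X.
    have /setU1P[->//|/setU1P[->//|zX]] := subsetP IxyX z zI.
    by rewrite setU1_id.
  have := leq_rank ziB (setUS _ BX); rewrite rz rX cardsU1 zB.
  by rewrite ltnn.
Qed.

Lemma rank_indep I : (I \in indep M) = (rank M I == #|I|).
Proof.
apply/idP/eqP=> [iI|rI].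
  apply/eqP; rewrite eqn_leq leq_rank // andbT.
  exact: (rank_function_le_card rank_function_rank).
have [B /basisP[iB BI rB]] := basis_exists I.
suff <- : B = I by [].
by apply/eqP; rewrite eqEcard BI -rI rB leqnn.
Qed.

Lemma rank_outside x : x \notin ground M -> rank M [set x] = 0.
Proof.
move=> xM; apply/eqP; rewrite -leqn0; apply/bigmax_leqP=> I /andP[iI].
rewrite subset1 => /orP[] /eqP Ie; last by rewrite Ie cards0.
by have := indep_ground iI; rewrite Ie sub1set (negPf xM).
Qed.

Lemma circuitP C : reflect
  [/\ C \subset ground M, C \notin indep M &
      forall x, x \in C -> C :\ x \in indep M]
  (C \in circuits M).
Proof.
rewrite inE; apply: (iffP minsetP) => /= [[/andP[CM dC] minC]|[CM dC minC]].
  split=> // x xC; apply/negPn/negP=> dCx.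
  have := minC (C :\ x); rewrite /= dCx (subset_trans (subsetDl _ _) CM).
  rewrite subsetDl => /(_ isT isT) eqC.
  by move: xC; rewrite -eqC !inE eqxx.
split=> [|D /andP[DM dD] DC]; first by rewrite CM dC.
apply/eqP; rewrite eqEsubset DC; apply/subsetP=> x xC.
apply/negPn/negP=> xD; case/negP: dD; apply: indepS (minC x xC) _.
by rewrite subsetD1 DC xD.
Qed.

Lemma circuits_restrict X C :
  (C \in circuits (restrict M X)) = (C \in circuits M) && (C \subset X).
Proof.
rewrite !inE andbC; have [CX|CX] := boolP (C \subset X); last first.
  apply/negP=> /minsetP[/=]; rewrite subsetI (negPf CX) andbF; by [].
apply/minsetP/minsetP=> /=; rewrite inE subsetI CX !andbT => -[h minC];
  split=> // D.
  move=> hD DC; apply: minC => //.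
  by rewrite inE subsetI (subset_trans DC CX) !andbT.
rewrite inE subsetI => hD DC; apply: minC => //.
by move: hD; rewrite (subset_trans DC CX) !andbT.
Qed.

Lemma circuit_spanned C X x :
  C \in circuits M -> x \in C -> C \subset x |: X ->
  rank M (x |: X) = rank M X.
Proof.
move=> /circuitP[_ dC iC] xC CX.
apply: (spanned_mono rank_function_rank (X := C :\ x)).
  by rewrite subDset.
rewrite setD1K //; apply/eqP.
rewrite eqn_leq (rank_subset (subsetDl _ _)) andbT.
have := iC x xC; rewrite rank_indep => /eqP ->.
have := rank_function_le_card rank_function_rank C.
rewrite leq_eqVlt -rank_indep (negPf dC) /= (cardsD1 x C) xC; by [].
Qed.

(** A minimal dependent subset of I + x contains x because I is
    independent. *)
Lemma circuit_in_adjoin I x : x \in ground M -> I \in indep M ->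
  x |: I \notin indep M ->
  exists C, [/\ C \in circuits M, C \subset x |: I & x \in C].
Proof.
move=> xM iI dxI.
have [|C minC CxI] := @minset_exists T
   [pred X : {set T} | (X \subset ground M) && (X \notin indep M)] (x |: I).
  by rewrite /= dxI subUset sub1set xM indep_ground.
have CM : C \in circuits M by rewrite inE.
exists C; split=> //; apply/negPn/negP=> xC.
have /circuitP[_ /negP[]] := CM; apply: indepS iI _.
exact: subset_adjoin CxI.
Qed.

End MatroidRank.

(** * Fundamental circuits *)

Section Fundamental.
Variables (T : finType) (M : matroid T).
Implicit Types (x y e : T) (X B C : {set T}).

(** The default set0 is returned only when B + e contains no circuit through
    e, for instance when B + e is independent. *)
Definition fundamental B e : {set T} :=
  odflt set0 [pick C in circuits M | (C \subset e |: B) && (e \in C)].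

Definition fundamental_circuits X B : {set {set T}} :=
  [set fundamental B e | e in (X :&: ground M) :\: B].

Lemma fundamentalP X B e : is_basis M X B -> e \in (X :&: ground M) :\: B ->
  [/\ fundamental B e \in circuits M, fundamental B e \subset e |: B &
      e \in fundamental B e].
Proof.
move=> /basisP[iB BX rX] /setDP[/setIP[eX eM] eB].
have dB : e |: B \notin indep M.
  apply/negP=> ieB; have /(leq_rank ieB) : e |: B \subset X.
    by rewrite subUset sub1set eX.
  by rewrite rX cardsU1 eB ltnn.
rewrite /fundamental; case: pickP => [C /and3P[]//|noC].
have [C [CM CeB eC]] := circuit_in_adjoin eM iB dB.
by have := noC C; rewrite CM CeB eC.
Qed.

Lemma fundamental_in_cover X B e : e \in (X :&: ground M) :\: B ->
  fundamental B e \subset cover (fundamental_circuits X B).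
Proof.
by move=> eY; apply: (bigcup_sup (fundamental B e)); rewrite ?imset_f.
Qed.

Lemma in_fundamental_notin X B e y : is_basis M X B ->
  e \in (X :&: ground M) :\: B -> y \in fundamental B e -> y \notin B -> y = e.
Proof.
move=> bB eY yC yB; have [_ CeB _] := fundamentalP bB eY.
by have /setU1P[//|] := subsetP CeB y yC; rewrite (negPf yB).
Qed.

Lemma cover_fundamental X B : is_basis M X B ->
  cover (fundamental_circuits X B) :\: B = (X :&: ground M) :\: B.
Proof.
move=> bB; apply/eqP; rewrite eqEsubset; apply/andP; split; apply/subsetP=> y.
  case/setDP=> /bigcupP[_ /imsetP[e eY ->] yC] yB.
  by rewrite (in_fundamental_notin bB eY yC yB).
move=> yY; have [_ _ yC] := fundamentalP bB yY.
rewrite inE (subsetP (fundamental_in_cover yY) y yC) andbT.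
by case/setDP: yY.
Qed.

Lemma card_fundamental X B : is_basis M X B ->
  #|fundamental_circuits X B| = #|(X :&: ground M) :\: B|.
Proof.
move=> bB; apply: card_in_imset => e e' eY e'Y eqC.
have [_ _ eC] := fundamentalP bB eY.
rewrite (in_fundamental_notin bB e'Y (y := e)) -?eqC //.
by case/setDP: eY.
Qed.

(** Each point of the union outside B closes a circuit with points of B that
    are themselves in the union, so B meets the union in a basis of it. *)
Lemma rank_cover_fundamental X B : is_basis M X B ->
  rank M (cover (fundamental_circuits X B)) =
  #|cover (fundamental_circuits X B) :&: B|.
Proof.
move=> bB; set U := cover _; have [iB _ _] := basisP bB.
have iUB : U :&: B \in indep M.
  have /matroid_axiomP[_ _ indepS _] := matroidP M.
  by apply: indepS iB _; apply: subsetIr.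
have <- : rank M (U :&: B) = #|U :&: B| by apply/eqP; rewrite -rank_indep.
rewrite -{1}(setUidPl (subsetIl U B)).
apply: (spanned_set (rank_function_rank M)) => y yU.
have [yB|yB] := boolP (y \in B); first by rewrite setU1_id // inE yU.
have yY : y \in (X :&: ground M) :\: B.
  by rewrite -(cover_fundamental bB) inE yB.
have [CM CyB yC] := fundamentalP bB yY.
apply: (circuit_spanned CM yC); apply/subsetP=> z zC.
have := subsetP CyB z zC; rewrite !inE => /orP[->//|->].
by rewrite (subsetP (fundamental_in_cover yY) z zC) orbT.
Qed.

(** The nullity of the union counts its points outside B, and each of these
    belongs to exactly one of the chosen circuits. *)
Lemma perfect_fundamental X B :
  is_basis M X B -> perfect M (fundamental_circuits X B).
Proof.
move=> bB; split.
- by apply/subsetP=> _ /imsetP[e eY ->]; case: (fundamentalP bB eY).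
- rewrite rank_cover_fundamental // card_fundamental // -cover_fundamental //.
  by rewrite cardsD.
move=> _ /imsetP[e eY ->]; have [_ _ eC] := fundamentalP bB eY.
apply/negP=> /subsetP/(_ e eC)/bigcupP[D /setD1P[neD /imsetP[e' e'Y eD]] eCD].
move: neD eCD; rewrite eD => neD eC'.
have eB : e \notin B by case/setDP: eY.
by rewrite (in_fundamental_notin bB e'Y eC' eB) eqxx in neD.
Qed.

(** A point x of C in B but in no chosen circuit would be a coloop of X: all
    the chosen circuits avoid x, so B - x spans C - x, hence, through C, also x,
    contradicting the independence of B. *)
Lemma circuit_sub_cover_fundamental X B C : is_basis M X B ->
  C \in circuits M -> C \subset X ->
  C \subset cover (fundamental_circuits X B).
Proof.
move=> bB CM CX; apply/subsetP=> x xC; set U := cover _.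
have [CE _ _] := circuitP _ _ CM; have [iB _ _] := basisP bB.
have inU y : y \in C -> y \notin B -> y \in (X :&: ground M) :\: B.
  by move=> yC yB; rewrite !inE yB (subsetP CX) ?(subsetP CE).
have [xB|xB] := boolP (x \in B); last first.
  by have := inU x xC xB; rewrite -(cover_fundamental bB) => /setDP[].
apply/negPn/negP=> xU.
have rhoM := rank_function_rank M.
have span : rank M (C :\ x :|: B :\ x) = rank M (B :\ x).
  apply: (spanned_set rhoM) => y /setD1P[yx yC].
  have [yB|yB] := boolP (y \in B); first by rewrite setU1_id // !inE yx.
  have yY := inU y yC yB; have [DM DyB yD] := fundamentalP bB yY.
  apply: (circuit_spanned DM yD); apply/subsetP=> z zD.
  have := subsetP DyB z zD; rewrite !inE => /orP[->//|->].
  rewrite andbT orbC; apply/orP; left; apply: contraNneq xU => <-.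
  exact: (subsetP (fundamental_in_cover yY)).
have : rank M B <= rank M (B :\ x).
  rewrite -span -(spanned_mono rhoM (subsetUl (C :\ x) (B :\ x)) (x := x)).
    by rewrite rank_subset // -{1}(setD1K xB) setUS // subsetUr.
  by apply: (circuit_spanned CM xC); rewrite setD1K.
apply/negP; rewrite -ltnNge.
move: iB; rewrite rank_indep => /eqP->; rewrite (cardsD1 x B) xB ltnS.
exact: rank_function_le_card.
Qed.

End Fundamental.

(** * The joint rank function on points and circuits *)

Section JointRank.
Variables (T : finType) (M : matroid T) (N : matroid {set T}).
Implicit Types (x y e : T) (X Y B C J : {set T}) (W : {set {set T}}).
Implicit Type Z : {set T + {set T}}.

Let rhoM := rank_function_rank M.
Let rhoN := rank_function_rank N.

Local Notation F X := (circuits (restrict M X)).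

Lemma circuits_mono X Y : X \subset Y -> F X \subset F Y.
Proof.
move=> XY; apply/subsetP=> C; rewrite !circuits_restrict => /andP[-> CX].
exact: subset_trans CX XY.
Qed.

(** A circuit through x inside X + x puts x in the closure of X. *)
Lemma circuits_coloop X x : rank M (x |: X) != rank M X -> F (x |: X) = F X.
Proof.
move=> rx; apply/eqP; rewrite eqEsubset (@circuits_mono X) ?subsetUr // andbT.
apply/subsetP=> C; rewrite !circuits_restrict => /andP[CM CxX].
rewrite CM; have [xC|xC] := boolP (x \in C).
  by rewrite (circuit_spanned CM xC CxX) eqxx in rx.
exact: subset_adjoin CxX.
Qed.

Lemma circuits_outside X : [disjoint X & ground M] -> F X = set0.
Proof.
move=> XM; apply/setP=> C; rewrite circuits_restrict in_set0.
apply/negP=> /andP[/circuitP[CM dC _] CX]; case/negP: dC.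
have /eqP-> : C == set0.
  by rewrite -subset0; move: XM; rewrite -setI_eq0 => /eqP<-; apply/subsetIP.
by have /matroid_axiomP[] := matroidP M.
Qed.

Lemma circuits_set0 : F set0 = set0.
Proof. by rewrite circuits_outside // -setI_eq0 set0I. Qed.

Lemma basis_mono X Y B : is_basis M X B -> X \subset Y ->
  rank M Y = rank M X -> is_basis M Y B.
Proof.
move=> /basisP[iB BX rX] XY rY; apply/maxsetP; split=> /=.
  by rewrite iB (subset_trans BX).
move=> D /andP[iD DY] BD; apply/esym/eqP.
by rewrite eqEcard BD -rX -rY leq_rank.
Qed.

Lemma fundamental_in_circuits X Y B e : is_basis M Y B ->
  e \in (Y :&: ground M) :\: B -> B \subset X -> e \in X ->
  fundamental M B e \in F X.
Proof.
move=> bB eY BX eX; have [CM CeB _] := fundamentalP bB eY.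
rewrite circuits_restrict CM (subset_trans CeB) //.
by rewrite subUset sub1set eX.
Qed.

Definition points Z : {set T} := [set x | inl x \in Z].

Definition circs Z : {set {set T}} := F (points Z) :|: [set C | inr C \in Z].

Definition joint_rank Z : nat := rank M (points Z) + rank N (circs Z).

Lemma in_circs C Z :
  (C \in circs Z) = (C \in F (points Z)) || (inr C \in Z).
Proof. by rewrite in_setU [X in _ || X]inE. Qed.

Lemma points_inl x Z : points (inl x |: Z) = x |: points Z.
Proof. by apply/setP=> y; rewrite !inE. Qed.

Lemma points_inr C Z : points (inr C |: Z) = points Z.
Proof. by apply/setP=> y; rewrite !inE. Qed.

Lemma circs_inr C Z : circs (inr C |: Z) = C |: circs Z.
Proof.
rewrite /circs points_inr setUCA; congr (_ :|: _).
by apply/setP=> D; rewrite !inE.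
Qed.

Lemma points_mono Z Z' : Z \subset Z' -> points Z \subset points Z'.
Proof. by move=> /subsetP ZZ'; apply/subsetP=> x; rewrite !inE => /ZZ'. Qed.

Lemma circs_mono Z Z' : Z \subset Z' -> circs Z \subset circs Z'.
Proof.
move=> ZZ'; apply: setUSS; first by rewrite circuits_mono ?points_mono.
by apply/subsetP=> C; rewrite !in_set => /(subsetP ZZ').
Qed.

Lemma joint_rank_mono Z Z' : Z \subset Z' -> joint_rank Z <= joint_rank Z'.
Proof.
by move=> ZZ'; rewrite leq_add // rank_subset ?circs_mono ?points_mono.
Qed.

(** Neither summand can decrease, so the sum is constant only if both are. *)
Lemma joint_spanned u Z : joint_rank (u |: Z) = joint_rank Z ->
  rank M (points (u |: Z)) = rank M (points Z) /\
  rank N (circs (u |: Z)) = rank N (circs Z).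
Proof.
move=> eqr; have sZ := subsetUr [set u] Z.
have leM := rank_subset M (points_mono sZ).
have leN := rank_subset N (circs_mono sZ).
split; apply/eqP; rewrite eqn_leq ?leM ?leN andbT.
  rewrite -(leq_add2r (rank N (circs (u |: Z)))) -/(joint_rank _) eqr.
  by rewrite leq_add2l.
rewrite -(leq_add2l (rank M (points (u |: Z)))) -/(joint_rank _) eqr.
by rewrite leq_add2r.
Qed.

Section PerfectSpans.
Hypothesis perfectN : forall CC : {set {set T}}, perfect M CC ->
  forall C : {set T}, C \in circuits M -> C \subset cover CC -> C \in cl N CC.

(** This is where the hypothesis on perfect collections enters: the
    fundamental circuits span all circuits of M|X. *)
Lemma circuits_spanned X B W : is_basis M X B ->
  (forall e, e \in (X :&: ground M) :\: B -> fundamental M B e \in W) ->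
  forall C, C \in F X -> rank N (C |: W) = rank N W.
Proof.
move=> bB fW C; rewrite circuits_restrict => /andP[CM CX].
apply: (spanned_mono rhoN (X := fundamental_circuits M X B)).
  by apply/subsetP=> _ /imsetP[e eY ->]; apply: fW.
have := perfectN (perfect_fundamental bB) CM
  (circuit_sub_cover_fundamental bB CM CX).
by rewrite inE => /andP[_ /eqP].
Qed.

(** The circuit D is the fundamental circuit of x: a basis of X is also one of
    X + x, and the other fundamental circuits lie in X. *)
Lemma circuits_adjoin_spanned1 X x : rank M (x |: X) = rank M X ->
  exists D, forall C, C \in F (x |: X) ->
    rank N (C |: (D |: F X)) = rank N (D |: F X).
Proof.
move=> rx; have [B bB] := basis_exists M X.
have bxB := basis_mono bB (subsetUr _ _) rx; have [_ BX _] := basisP bB.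
exists (fundamental M B x); apply: (circuits_spanned bxB) => e eY.
have /setDP[/setIP[/setU1P[->|eX] _] _] := eY; first exact: setU11.
by rewrite in_setU1 (fundamental_in_circuits bxB eY BX eX) orbT.
Qed.

(** A basis of X is also one of X + x + y, and each fundamental circuit has one
    point outside it, so it misses x or y. *)
Lemma circuits_adjoin_spanned2 X x y :
  rank M (x |: X) = rank M X -> rank M (y |: X) = rank M X ->
  forall C, C \in F (x |: (y |: X)) ->
    rank N (C |: (F (x |: X) :|: F (y |: X))) =
    rank N (F (x |: X) :|: F (y |: X)).
Proof.
move=> rx ry; have [B bB] := basis_exists M X.
have rxy : rank M (x |: (y |: X)) = rank M X by have [_ _ ->] := rhoM.
have sX : X \subset x |: (y |: X) by rewrite setUA subsetUr.
have bB2 := basis_mono bB sX rxy; have [_ BX _] := basisP bB.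
have BzX z : B \subset z |: X by rewrite (subset_trans BX) ?subsetUr.
apply: (circuits_spanned bB2) => e eY; rewrite in_setU.
have fF z := fundamental_in_circuits bB2 eY (BzX z).
have /setDP[/setIP[/setU1P[ex|eyX] _] _] := eY.
  by rewrite (fF x) // ex setU11.
by rewrite (fF y) ?orbT.
Qed.

(** Only one of the two summands can grow when a point is added: r_N if the
    point is in the closure, r_M if it is not. *)
Lemma joint_rank_adjoin u Z : joint_rank (u |: Z) <= (joint_rank Z).+1.
Proof.
have [_ rM1 _] := rhoM; have [_ rN1 _] := rhoN; rewrite /joint_rank.
case: u => [x|C]; last first.
  rewrite points_inr circs_inr -addnS leq_add2l.
  by case/andP: (rN1 C (circs Z)).
rewrite points_inl.
have [rx|rx] := eqVneq (rank M (x |: points Z)) (rank M (points Z)).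
  rewrite rx -addnS leq_add2l.
  have [D spD] := circuits_adjoin_spanned1 rx.
  have /andP[_] := rN1 D (circs Z); apply: leq_trans.
  rewrite -(@spanned_set _ _ rhoN (D |: circs Z) (circs (inl x |: Z))) => [|C].
    by rewrite rank_subset ?subsetUl.
  rewrite in_circs points_inl in_setU1 => /orP[/spD|/= CZ].
    by apply: spanned_mono; rewrite // setUS ?subsetUl.
  by rewrite setU1_id // in_setU1 in_circs CZ !orbT.
have -> : circs (inl x |: Z) = circs Z.
  rewrite /circs points_inl circuits_coloop //; congr (_ :|: _).
  by apply/setP=> C; rewrite !inE.
by rewrite -addSn leq_add2r; case/andP: (rM1 x (points Z)).
Qed.

Lemma rank_function_joint : rank_function joint_rank.
Proof.
have [rM0 _ rM2] := rhoM; have [rN0 _ _] := rhoN.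
split.
- have p0 : points set0 = set0 by apply/setP=> x; rewrite !inE.
  rewrite /joint_rank /circs p0 rM0 circuits_set0 set0U.
  by rewrite -[RHS]rN0; congr rank; apply/setP=> C; rewrite !inE.
- by move=> u Z; rewrite joint_rank_mono ?subsetUr // joint_rank_adjoin.
move=> u v Z /joint_spanned[rMu rNu] /joint_spanned[rMv rNv].
set Zuv := u |: (v |: Z); rewrite /joint_rank; congr addn.
  rewrite /Zuv; case: u v rMu rMv {rNu rNv Zuv} => [x|C] [y|D];
    by rewrite ?points_inl ?points_inr ?points_inl // => rx ry; apply: rM2.
(* W is spanned by circs Z, so it suffices that W spans circs Zuv. *)
pose W := circs (u |: Z) :|: circs (v |: Z).
have WZ : rank N (W :|: circs Z) = rank N (circs Z).
  apply: (spanned_set rhoN) => C /setUP[] CW.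
    by apply: (spanned_in rhoN) CW => //; rewrite circs_mono ?subsetUr.
  by apply: (spanned_in rhoN) CW => //; rewrite circs_mono ?subsetUr.
rewrite -(setUidPl (_ : circs Z \subset circs Zuv)); last first.
  by rewrite circs_mono // /Zuv setUA subsetUr.
apply: (spanned_trans rhoN WZ) => C; rewrite in_circs => /orP[]; last first.
  rewrite !in_setU1 => Cuv; rewrite setU1_id // in_setU !in_circs !in_setU1.
  by case/or3P: Cuv => ->; rewrite !orbT.
(* New circuits of M can arise only when both u and v are points. *)
rewrite /W /Zuv; case: u v rMu rMv {rNu rNv W WZ Zuv} => [x|C'] [y|D] rMu rMv.
- rewrite !points_inl in rMu rMv *; move/(circuits_adjoin_spanned2 rMu rMv).
  apply: (spanned_mono rhoN); rewrite /circs !points_inl.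
  by rewrite setUSS ?subsetUl.
- rewrite points_inl points_inr => CF; rewrite setU1_id //.
  by rewrite in_setU in_circs points_inl CF.
- rewrite points_inr points_inl => CF; rewrite setU1_id //.
  by rewrite in_setU [X in _ || X]in_circs points_inl CF !orbT.
rewrite !points_inr => CF; rewrite setU1_id //.
by rewrite in_setU in_circs points_inr CF.
Qed.

End PerfectSpans.

Definition joint_ground : {set T + {set T}} :=
  inl @: ground M :|: inr @: ground N.

Lemma points_imset_inl X Z : points Z = set0 -> points (inl @: X :|: Z) = X.
Proof.
move=> Z0; apply/setP=> x; rewrite !inE mem_imset; last exact: inl_inj.
by have := in_set0 x; rewrite -Z0 inE => ->; rewrite orbF.
Qed.

Lemma points_sub_inr Z W : Z \subset inr @: W -> points Z = set0.
Proof.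
move=> ZW; apply/setP=> x; rewrite !inE; apply/negP=> /(subsetP ZW).
by case/imsetP.
Qed.

Lemma joint_outside u : u \notin joint_ground -> joint_rank [set u] = 0.
Proof.
have [rM0 _ _] := rhoM; have [rN0 _ _] := rhoN.
rewrite inE negb_or; case: u => [x|C] /andP[xM CN]; rewrite /joint_rank /circs.
  have -> : points [set inl x] = [set x] by apply/setP=> y; rewrite !inE.
  move: xM; rewrite mem_imset; last exact: inl_inj.
  move=> xM; rewrite rank_outside // circuits_outside ?disjoints1 // set0U.
  by rewrite -[RHS]rN0; congr rank; apply/setP=> C; rewrite !inE.
have -> : points [set inr C] = set0 by apply/setP=> y; rewrite !inE.
rewrite rM0 circuits_set0 set0U.
move: CN; rewrite mem_imset; last exact: inr_inj.
move=> CN; rewrite -[RHS](rank_outside CN); congr rank.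
by apply/setP=> D; rewrite !inE.
Qed.

Lemma joint_rank_inl X : joint_rank (inl @: X) = lift_rank M N X.
Proof.
have -> : inl @: X = inl @: X :|: set0 :> {set T + {set T}} by rewrite setU0.
have p0 : points set0 = set0 by apply/setP=> x; rewrite !inE.
rewrite /joint_rank /circs points_imset_inl //; congr (_ + rank N _).
apply/setP=> C; rewrite in_setU [X in _ || X]inE setU0.
by case: imsetP => [[]//|_]; rewrite orbF.
Qed.

(** * Deletion and contraction of the circuits *)

Section LiftMatroid.
Hypothesis groundN : ground N = circuits M.
Hypothesis perfectN : forall CC : {set {set T}}, perfect M CC ->
  forall C : {set T}, C \in circuits M -> C \subset cover CC -> C \in cl N CC.

Let rho_joint := rank_function_joint perfectN.

Definition joint_matroid := matroid_of_rank rho_joint joint_outside.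

Let P := joint_matroid.

Lemma rank_function_lift :
  rank_function (fun X => joint_rank (inl @: X)).
Proof.
have [r0 r1 r2] := rho_joint; split.
- by rewrite imset0.
- by move=> x X; rewrite imsetU1.
by move=> x y X; rewrite !imsetU1; apply: r2.
Qed.

Lemma lift_outside x : x \notin ground M -> joint_rank (inl @: [set x]) = 0.
Proof.
move=> xM; rewrite imset_set1 joint_outside // in_setU negb_or.
rewrite mem_imset ?xM; last exact: inl_inj.
by apply/imsetP=> -[].
Qed.

(** This matroid is the joint matroid without its circuits, defined directly
    on T from the rank function so that no relabelling along [inl] has to be
    undone. *)
Definition lift_matroid := matroid_of_rank rank_function_lift lift_outside.

Lemma rank_lift_matroid X : rank lift_matroid X = lift_rank M N X.
Proof. by rewrite rank_matroid_of_rank joint_rank_inl. Qed.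

Lemma matroid_rank_lift :
  matroid_rank lift_matroid = matroid_rank M + matroid_rank N.
Proof.
rewrite /matroid_rank rank_lift_matroid /lift_rank groundN.
congr (_ + rank N _); apply/setP=> C.
by rewrite circuits_restrict andb_idr // => /circuitP[].
Qed.

(** Contracting all the circuits removes the contribution of N: a basis B of
    their set spans, in the joint matroid, all circuits of M, so the term r_N is
    already r(N), which is #|B|. *)
Lemma joint_rank_basis (B : {set T + {set T}}) J :
  is_basis P (inr @: ground N) B ->
  joint_rank (inl @: J :|: B) = rank M J + #|B|.
Proof.
move=> /basisP[iB BX rB]; have [rM0 _ _] := rhoM.
have pB := points_sub_inr BX.
have pX := points_sub_inr (subxx (inr @: ground N)).
apply/eqP; rewrite eqn_leq; apply/andP; split.
  rewrite (leq_trans (joint_rank_mono (setUS _ BX))) //.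
  rewrite -rB rank_matroid_of_rank /joint_rank points_imset_inl // pX rM0 add0n.
  rewrite leq_add2l rank_subset //; apply/subsetP=> C.
  rewrite !in_circs => /orP[|].
    rewrite circuits_restrict -groundN => /andP[CN _].
    by rewrite imset_f ?orbT.
  by case/setUP=> [/imsetP[]//|->]; rewrite orbT.
have -> : #|B| = joint_rank B by apply/esym/eqP; move: iB; rewrite inE.
rewrite /joint_rank points_imset_inl // pB rM0 add0n leq_add2l.
by rewrite rank_subset ?circs_mono ?subsetUr.
Qed.

Lemma card_inl_disjoint J Z : Z \subset inr @: ground N ->
  #|inl @: J :|: Z| = #|J| + #|Z|.
Proof.
move=> ZX; rewrite cardsU card_imset; last exact: inl_inj.
rewrite (_ : _ :&: _ = set0) ?cards0 ?subn0 //.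
apply/setP=> u; rewrite !inE; apply/negP=> /andP[/imsetP[x _ ->]].
by move=> /(subsetP ZX)/imsetP[].
Qed.

Lemma is_lift_matroid : is_lift lift_matroid M.
Proof.
have dis (I : {set T}) : [disjoint inl @: I & inr @: ground N].
  rewrite -setI_eq0; apply/eqP/setP=> u; rewrite !inE.
  by apply/negP=> /andP[/imsetP[x _ ->] /imsetP[]].
have sub_inl (I : {set T + {set T}}) :
    I \subset joint_ground -> [disjoint I & inr @: ground N] ->
    I = inl @: points I.
  move=> IE IX; apply/setP=> -[x|C].
    by rewrite mem_imset ?inE //; apply: inl_inj.
  rewrite [RHS](_ : _ = false); last by apply/imsetP=> -[].
  apply/negP=> CI; have /setUP[/imsetP[]//|CN] := subsetP IE _ CI.
  by rewrite (disjointFr IX CI) in CN.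
have indep_ground (I : {set T + {set T}}) :
    I \in indep P -> I \subset joint_ground.
  by have /matroid_axiomP[h _ _ _] := matroidP P; apply: h.
exists (T + {set T})%type, inl, (@inl_inj _ _), P, (inr @: ground N); split.
- exact: subsetUr.
- apply: matroid_eq => /=.
    by rewrite -setDE setDUl setDv setU0; apply/setDidPl/dis.
  apply/setP=> I; rewrite in_set -disjoints_subset.
  apply/andP/imsetP=> [[iI IX]|[J iJ ->]].
    have eI := sub_inl _ (indep_ground _ iI) IX.
    exists (points I) => //; move: iI.
    by rewrite {1}eI !inE card_imset //; apply: inl_inj.
  split; last exact: dis.
  by move: iJ; rewrite !inE card_imset //; apply: inl_inj.
apply: matroid_eq => /=.
  by rewrite setDUl setDv setU0; apply/setDidPl/dis.
have key J (B : {set T + {set T}}) : is_basis P (inr @: ground N) B ->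
    (inl @: J :|: B \in indep P) = (J \in indep M).
  move=> bB; have [_ BX _] := basisP bB.
  by rewrite inE joint_rank_basis // card_inl_disjoint // eqn_add2r -rank_indep.
apply/setP=> I; rewrite in_set.
apply/andP/imsetP=> [[IX /existsP[B /andP[bB iIB]]]|[J iJ ->]].
  have IE := subset_trans (subsetUl _ _) (indep_ground _ iIB).
  exists (points I); last exact: sub_inl.
  by rewrite -(key _ B) // -sub_inl.
split; first exact: dis.
have [B bB] := basis_exists P (inr @: ground N).
by apply/existsP; exists B; rewrite bB key.
Qed.

End LiftMatroid.
End JointRank.

Theorem theorem1p2 (T : finType) (M : matroid T) (N : matroid {set T})
  (groundN : ground N = circuits M)
  (perfectN : forall CC : {set {set T}}, perfect M CC ->
     forall C : {set T}, C \in circuits M -> C \subset cover CC ->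
       C \in cl N CC) :
  exists MN : matroid T,
    [/\ ground MN = ground M,
        forall X : {set T}, X \subset ground M ->
          rank MN X = lift_rank M N X &
        is_rank_lift (matroid_rank N) MN M].
Proof.
exists (lift_matroid perfectN); split=> // [X _|].
  exact: rank_lift_matroid.
by split; [apply: is_lift_matroid | apply: matroid_rank_lift].
Qed.
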